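(* Let $X$ be a pointed metric space and $E$ a Banach space over $\mathbb{K}$. A norm $\alpha$ on $X\boxtimes E$ is a dualizable Lipschitz cross-norm if and only if $\varepsilon\leq\alpha\leq\pi$ (pointwise on $X\boxtimes E$).
   Context: $\mathbb{K}$ is $\mathbb{R}$ or $\mathbb{C}$. A pointed metric space $X$ is a metric space (with metric $d$) with a distinguished base point $0$. For a pointed metric space $X$ and a Banach space $F$, $\mathrm{Lip}_0(X,F)$ is the Banach space of all Lipschitz maps $f\colon X\to F$ with $f(0)=0$, normed by the least Lipschitz constant $\mathrm{Lip}(f)$; $X^\#=\mathrm{Lip}_0(X,\mathbb{K})$. $B_Z$ denotes the closed unit ball of a normed space $Z$. $E^*$ is the topological dual of $E$ and $\langle\phi,e\rangle=\phi(e)$; $V'$ denotes the algebraic dual of a vector space $V$. For $x,y\in X$ and $e\in E$, $\delta_{(x,y)}\boxtimes e\in \mathrm{Lip}_0(X,E^* )'$ is the linear functional $f\mapsto\langle f(x)-f(y),e\rangle$. The Lipschitz tensor product $X\boxtimes E$ is the linear subspace of $\mathrm{Lip}_0(X,E^* )'$ spanned by all the functionals $\delta_{(x,y)}\boxtimes e$ with $x,y\in X$, $e\in E$. Every $u\in X\boxtimes E$ can be written (non-uniquely) as $u=\sum_{i=1}^n\delta_{(x_i,y_i)}\boxtimes e_i$. For $u=\sum_{i=1}^n \delta_{(x_i,y_i)}\boxtimes e_i\in X\boxtimes E$ (independently of the representation), $$\varepsilon(u)=\sup\left\{\left|\sum_{i=1}^n(g(x_i)-g(y_i))\langle\phi,e_i\rangle\right|\colon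 g\in B_{X^\#},\ \phi\in B_{E^*}\right\},$$ and $$\pi(u)=\inf\left\{\sum_{i=1}^n d(x_i,y_i)\|e_i\|\colon u=\sum_{i=1}^n\delta_{(x_i,y_i)}\boxtimes e_i\right\},$$ the infimum being over all representations of $u$. A norm $\alpha$ on $X\boxtimes E$ is a Lipschitz cross-norm if $\alpha(\delta_{(x,y)}\boxtimes e)=d(x,y)\|e\|$ for all $x,y\in X$, $e\in E$. A Lipschitz cross-norm $\alpha$ is dualizable if for all $g\in X^\#$, $\phi\in E^*$ and all $\sum_{i=1}^n\delta_{(x_i,y_i)}\boxtimes e_i\in X\boxtimes E$, $\left|\sum_{i=1}^n(g(x_i)-g(y_i))\langle\phi,e_i\rangle\right|\leq\mathrm{Lip}(g)\|\phi\|\,\alpha\left(\sum_{i=1}^n \delta_{(x_i,y_i)}\boxtimes e_i\right)$. *)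

(* Defs.v *)
From HB Require Import structures.
From mathcomp Require Import all_boot all_order all_algebra.
From mathcomp Require Import all_classical all_reals all_analysis.
From mathcomp Require Import complex.

Set Implicit Arguments.
Unset Strict Implicit.
Unset Printing Implicit Defensive.

Import Order.TTheory GRing.Theory Num.Theory.
Import numFieldNormedType.Exports.
Local Open Scope classical_set_scope.
Local Open Scope ring_scope.

(* The base point of a pointed metric space is [point]. *)
#[short(type="pointedMetricType")]
HB.structure Definition PointedMetric (R : numDomainType) :=
  {M of Metric R M & isPointed M}.

Variant scalar_kind := RealScalars | ComplexScalars.

Definition scalars (R : realType) (k : scalar_kind) : numFieldType :=
  match k with RealScalars => R | ComplexScalars => R[i] end.

Section RealValues.
Context (R : realType) (k : scalar_kind).
Local Notation K := (scalars R k).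

Definition of_real : R -> K :=
  match k return R -> scalars R k with
  | RealScalars => fun x => x
  | ComplexScalars => fun x => real_complex R x
  end.

Definition re_part : K -> R :=
  match k return scalars R k -> R with
  | RealScalars => fun z => z
  | ComplexScalars => fun z => complex.Re z
  end.

Lemma of_realK : cancel of_real re_part.
Proof. by rewrite /of_real /re_part; case: k. Qed.

Lemma re_partK (z : K) : 0 <= z -> of_real (re_part z) = z.
Proof.
rewrite /of_real /re_part; case: k z => //= -[a b].
by rewrite lecE /= => /andP[/eqP -> _].
Qed.

Lemma re_part_le (z w : K) : z <= w -> re_part z <= re_part w.
Proof.
rewrite /re_part; case: k z w => //= -[a b] [c d].
by rewrite lecE => /andP[].
Qed.

Lemma re_partD (z w : K) : re_part (z + w) = re_part z + re_part w.
Proof. by rewrite /re_part; case: k z w => //= -[a b] [c d]. Qed.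

Lemma re_part0 : re_part 0 = 0.
Proof. by rewrite /re_part; case: k. Qed.

Lemma of_realM (a b : R) : of_real (a * b) = of_real a * of_real b.
Proof. by rewrite /of_real; case: k => //=; rewrite rmorphM. Qed.

Lemma of_realD (a b : R) : of_real (a + b) = of_real a + of_real b.
Proof. by rewrite /of_real; case: k => //=; rewrite rmorphD. Qed.

Lemma of_real_le (a b : R) : (of_real a <= of_real b) = (a <= b).
Proof. by rewrite /of_real; case: k => //=; rewrite lecR. Qed.

(* Library norms take values in K; [nrm v] is the same nonnegative number,
   as an element of R. *)
Definition nrm (V : normedModType K) (v : V) : R := re_part `|v|.

Lemma of_real_nrm (V : normedModType K) (v : V) : of_real (nrm v) = `|v|.
Proof. by rewrite re_partK. Qed.

Lemma nrm_ge0 (V : normedModType K) (v : V) : 0 <= nrm v.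
Proof. by rewrite -re_part0; exact: re_part_le. Qed.

Lemma nrmD (V : normedModType K) (v w : V) : nrm (v + w) <= nrm v + nrm w.
Proof. by rewrite -re_partD; apply/re_part_le/ler_normD. Qed.

Lemma nrmZ (V : normedModType K) (a : K) (v : V) :
  nrm (a *: v) = nrm (a : K^o) * nrm v.
Proof. by apply: (can_inj of_realK); rewrite of_realM !of_real_nrm normrZ. Qed.

Lemma nrm0 (V : normedModType K) : nrm (0 : V) = 0.
Proof. by rewrite /nrm normr0 re_part0. Qed.

Lemma nrm0_eq0 (V : normedModType K) (v : V) : nrm v = 0 -> v = 0.
Proof.
by move=> v0; apply: normr0_eq0; rewrite -of_real_nrm v0 -re_part0 re_partK.
Qed.

Lemma nrm_of_real (a : R) : 0 <= a -> nrm (of_real a : K^o) = a.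
Proof.
move=> a0; rewrite /nrm ger0_norm ?of_realK//.
by rewrite -(re_partK (lexx 0)) re_part0 of_real_le.
Qed.

Lemma nrm1 : nrm (1 : K^o) = 1.
Proof. by rewrite /nrm normr1 /re_part; case: k. Qed.

End RealValues.

Section Dual.
Context (R : realType) (k : scalar_kind) (E : normedModType (scalars R k)).
Local Notation K := (scalars R k).

Definition dual_pred : {pred (E -> K^o)} :=
  mem [set phi : E -> K^o | linear phi /\ continuous phi].

Record dual := Dual { dual_fun :> E -> K^o; _ : dual_fun \in dual_pred }.

HB.instance Definition _ := [isSub for dual_fun].
HB.instance Definition _ := gen_eqMixin dual.
HB.instance Definition _ := gen_choiceMixin dual.

Lemma dual_submod_closed : submod_closed dual_pred.
Proof.
split=> [|a f g]; rewrite !inE/=.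
  split=> [b u v|]; last exact: cst_continuous.
  by rewrite scaler0 addr0.
move=> [lf cf] [lg cg]; split=> [b u v|x].
  rewrite !fctE/= lf lg !scalerDr -!addrA; congr (_ + _).
    by rewrite !scalerA mulrC.
  by rewrite addrCA.
by apply: cvgD; [apply: cvgZr; exact: cf|exact: cg].
Qed.

HB.instance Definition _ :=
  GRing.isSubmodClosed.Build _ _ dual_pred dual_submod_closed.
HB.instance Definition _ := [SubChoice_isSubLmodule of dual by <:].

Lemma dual_linear (phi : dual) : linear phi.
Proof. by have := valP phi; rewrite inE => -[]. Qed.

Lemma dual_continuous (phi : dual) : continuous phi.
Proof. by have := valP phi; rewrite inE => -[]. Qed.

HB.instance Definition _ (phi : dual) :=
  GRing.isLinear.Build K E K^o _ phi (dual_linear phi).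

Lemma dual_bounded (phi : dual) :
  exists2 C : R, 0 <= C & forall e, nrm (phi e) <= C * nrm e.
Proof.
have /linear_bounded_continuous/linear_boundedP := @dual_continuous phi.
move=> /pinfty_ex_gt0[C C0 Cphi]; exists (re_part C).
  by rewrite -(@re_part0 R k); exact/re_part_le/ltW.
move=> e; rewrite -(@of_real_le R k) of_realM !of_real_nrm re_partK ?(ltW C0)//.
exact: Cphi.
Qed.

Definition dual_norm (phi : dual) : R :=
  sup [set nrm (phi e) | e in [set e : E | nrm e <= 1]].

Let dset (phi : dual) := [set nrm (phi e) | e in [set e : E | nrm e <= 1]].

Let dset_sup (phi : dual) : has_sup (dset phi).
Proof.
split; first by exists (nrm (phi 0)), 0 => //=; rewrite nrm0.
have [C C0 Cphi] := dual_bounded phi; exists C => _ [e /= e1 <-].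
by rewrite (le_trans (Cphi e))// ler_piMr.
Qed.

Lemma dual_norm_ge0 (phi : dual) : 0 <= dual_norm phi.
Proof.
have [_ ub] := dset_sup phi.
apply: le_trans (ub_le_sup ub _); first exact: (nrm_ge0 (phi 0)).
by exists 0 => //=; rewrite nrm0.
Qed.

Lemma dual_norm_ge (phi : dual) (e : E) : nrm (phi e) <= dual_norm phi * nrm e.
Proof.
have [e0|e0] := eqVneq (nrm e) 0.
  by rewrite (nrm0_eq0 e0) linear0 !nrm0 mulr0.
have ep : 0 < nrm e by rewrite lt_neqAle eq_sym e0 nrm_ge0.
set a := of_real k (nrm e)^-1.
have na : nrm (a : K^o) = (nrm e)^-1 by rewrite nrm_of_real ?invr_ge0 ?nrm_ge0.
have : dset phi (nrm (phi (a *: e))).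
  by exists (a *: e) => //=; rewrite nrmZ na mulVf.
move=> /(ub_le_sup (dset_sup phi).2).
by rewrite linearZ nrmZ na ler_pdivrMl// mulrC.
Qed.

Lemma dual_norm_le (phi : dual) (C : R) :
  (forall e, nrm e <= 1 -> nrm (phi e) <= C) -> dual_norm phi <= C.
Proof. by move=> H; apply: ge_sup (dset_sup phi).1 _ => _ [e /H ? <-]. Qed.

Let normd (phi : dual) : K := of_real k (dual_norm phi).

Let normdD (phi psi : dual) : normd (phi + psi) <= normd phi + normd psi.
Proof.
rewrite -of_realD of_real_le; apply: dual_norm_le => e e1.
apply: le_trans (nrmD (phi e) (psi e)) _.
by apply: lerD; (apply: le_trans (dual_norm_ge _ e) _);
  rewrite ler_piMr// dual_norm_ge0.
Qed.

Let dual_normZ_le (l : K) (phi : dual) :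
  dual_norm (l *: phi) <= nrm (l : K^o) * dual_norm phi.
Proof.
apply: dual_norm_le => e e1; rewrite [nrm _](nrmZ l (phi e)).
rewrite ler_wpM2l ?nrm_ge0//; apply: le_trans (dual_norm_ge _ e) _.
by rewrite ler_piMr// dual_norm_ge0.
Qed.

Let normd0_eq0 (phi : dual) : normd phi = 0 -> phi = 0.
Proof.
move=> /(congr1 (@re_part R k)); rewrite of_realK re_part0 => phi0.
apply/val_inj/funext => e /=; apply: (@nrm0_eq0 R k K^o); apply: le_anti.
by rewrite nrm_ge0 andbT (le_trans (dual_norm_ge phi e))// phi0 mul0r.
Qed.

Let normdZ (l : K) (phi : dual) : normd (l *: phi) = `|l| * normd phi.
Proof.
rewrite -(of_real_nrm (l : K^o)) -of_realM; congr of_real.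
apply: le_anti; rewrite dual_normZ_le/=.
have [->|l0] := eqVneq l 0; first by rewrite nrm0 mul0r dual_norm_ge0.
have lp : 0 < nrm (l : K^o).
  rewrite lt_neqAle nrm_ge0 andbT eq_sym; apply: contra l0 => /eqP.
  by move=> /nrm0_eq0 ->.
rewrite -ler_pdivlMl//; have := dual_normZ_le l^-1 (l *: phi).
rewrite scalerA mulVf// scale1r => /le_trans; apply.
rewrite ler_wpM2r ?dual_norm_ge0// -(ler_pM2r lp).
have := nrmZ l^-1 (l : K^o); rewrite /GRing.scale/= mulVf// => <-.
by rewrite nrm1 mulVf// gt_eqF.
Qed.

HB.instance Definition _ := Lmodule_isNormed.Build K dual normdD normdZ normd0_eq0.

Lemma dual_normE (phi : dual) : nrm phi = dual_norm phi.
Proof. exact: of_realK. Qed.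

End Dual.

Section Lip0.
Context (R : realType) (k : scalar_kind) (X : pointedMetricType R).
Local Notation K := (scalars R k).
Context (F : normedModType K).

Definition lip_const (f : X -> F) : set R :=
  [set L | 0 <= L /\ forall x y, nrm (f x - f y) <= L * mdist x y].

Definition lip0_pred : {pred (X -> F)} :=
  mem [set f : X -> F | f point = 0 /\ lip_const f !=set0].

Record lip0 := Lip0 { lip0_fun :> X -> F; _ : lip0_fun \in lip0_pred }.

HB.instance Definition _ := [isSub for lip0_fun].
HB.instance Definition _ := gen_eqMixin lip0.
HB.instance Definition _ := gen_choiceMixin lip0.

Lemma lip0_submod_closed : submod_closed lip0_pred.
Proof.
split=> [|a f g]; rewrite !inE/=.
  split=> //; exists 0; split=> // x y.
  by rewrite [_ - _](subr0 (0 : F)) nrm0 mul0r.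
move=> [f0 [L [L0 Lf]]] [g0 [M [M0 Mg]]]; split.
  by rewrite [LHS](_ : _ = a *: f point + g point)// f0 g0 scaler0 addr0.
exists (nrm (a : K^o) * L + M); split=> [|x y].
  by rewrite addr_ge0// mulr_ge0// nrm_ge0.
rewrite [_ - _](_ : _ = a *: (f x - f y) + (g x - g y)); last first.
  by rewrite scalerBr addrACA -opprD.
rewrite (le_trans (nrmD _ _))// mulrDl lerD// nrmZ -mulrA.
by rewrite ler_wpM2l// nrm_ge0.
Qed.

HB.instance Definition _ :=
  GRing.isSubmodClosed.Build _ _ lip0_pred lip0_submod_closed.
HB.instance Definition _ := [SubChoice_isSubLmodule of lip0 by <:].

(* The least Lipschitz constant. *)
Definition Lip (f : lip0) : R := inf (lip_const f).

End Lip0.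

Section AlgebraicDual.
Context (K : numFieldType) (V : lmodType K).

Definition alg_dual_pred : {pred (V -> K^o)} :=
  mem [set phi : V -> K^o | linear phi].

Record alg_dual :=
  AlgDual { alg_dual_fun :> V -> K^o; _ : alg_dual_fun \in alg_dual_pred }.

HB.instance Definition _ := [isSub for alg_dual_fun].
HB.instance Definition _ := gen_eqMixin alg_dual.
HB.instance Definition _ := gen_choiceMixin alg_dual.

Lemma alg_dual_submod_closed : submod_closed alg_dual_pred.
Proof.
split=> [|a f g]; rewrite !inE/=.
  by move=> b u v; rewrite scaler0 addr0.
move=> lf lg b u v.
rewrite !fctE/= lf lg !scalerDr -!addrA; congr (_ + _).
  by rewrite !scalerA mulrC.
by rewrite addrCA.
Qed.

HB.instance Definition _ :=
  GRing.isSubmodClosed.Build _ _ alg_dual_pred alg_dual_submod_closed.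
HB.instance Definition _ := [SubChoice_isSubLmodule of alg_dual by <:].

End AlgebraicDual.

Section IsNorm.
Context (R : realType) (k : scalar_kind) (V : lmodType (scalars R k)).

Definition is_norm (N : V -> R) : Prop :=
  [/\ forall u, 0 <= N u,
      forall u, N u = 0 -> u = 0,
      forall a u, N (a *: u) = nrm (a : (scalars R k)^o) * N u
    & forall u v, N (u + v) <= N u + N v].

End IsNorm.

Section LipschitzTensorProduct.
Context (R : realType) (k : scalar_kind) (X : pointedMetricType R).
Local Notation K := (scalars R k).
Context (E : normedModType K).

Definition delta_fun (x y : X) (e : E) (f : lip0 X (dual E)) : K^o :=
  (f x - f y) e.

Lemma delta_subproof x y e : delta_fun x y e \in @alg_dual_pred K (lip0 X (dual E)).
Proof.
rewrite inE/= => a f g; rewrite /delta_fun/=.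
by rewrite opprD addrACA -scalerBr.
Qed.

Definition delta x y e : alg_dual (lip0 X (dual E)) := AlgDual (delta_subproof x y e).

(* Linear combinations of the functionals [delta x y e]. *)
Definition lip_tensor_pred : {pred (alg_dual (lip0 X (dual E)))} :=
  mem [set u | exists s : seq (K * (X * X * E)),
    u = \sum_(t <- s) t.1 *: delta t.2.1.1 t.2.1.2 t.2.2].

Record lip_tensor :=
  LipTensor { lip_tensor_val :> alg_dual (lip0 X (dual E));
              _ : lip_tensor_val \in lip_tensor_pred }.

HB.instance Definition _ := [isSub for lip_tensor_val].
HB.instance Definition _ := gen_eqMixin lip_tensor.
HB.instance Definition _ := gen_choiceMixin lip_tensor.

Lemma lip_tensor_submod_closed : submod_closed lip_tensor_pred.
Proof.
split=> [|a u v]; rewrite !inE/=; first by exists [::]; rewrite big_nil.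
move=> [s ->] [t ->]; exists ([seq (a * p.1, p.2) | p <- s] ++ t).
rewrite big_cat big_map/= scaler_sumr; congr (_ + _).
by apply: eq_bigr => p _; rewrite scalerA.
Qed.

HB.instance Definition _ :=
  GRing.isSubmodClosed.Build _ _ lip_tensor_pred lip_tensor_submod_closed.
HB.instance Definition _ := [SubChoice_isSubLmodule of lip_tensor by <:].

Lemma box_subproof x y e : delta x y e \in lip_tensor_pred.
Proof.
by rewrite inE/=; exists [:: (1, (x, y, e))]; rewrite big_seq1 scale1r.
Qed.

Definition box x y e : lip_tensor := LipTensor (box_subproof x y e).

(* [s] lists the triples (x_i, y_i, e_i) of a representation. *)
Definition rep_sum (s : seq (X * X * E)) : lip_tensor :=
  \sum_(t <- s) box t.1.1 t.1.2 t.2.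

Lemma deltaZ (a : K) x y e : a *: delta x y e = delta x y (a *: e).
Proof.
by apply/val_inj/funext => f /=; rewrite /delta_fun linearZ.
Qed.

Lemma val_rep_sum (s : seq (X * X * E)) :
  val (rep_sum s) = \sum_(t <- s) delta t.1.1 t.1.2 t.2.
Proof. by rewrite /rep_sum raddf_sum. Qed.

Lemma ex_rep (u : lip_tensor) : exists s, u = rep_sum s.
Proof.
have := valP u; rewrite inE/= => -[s us].
exists [seq (p.2.1.1, p.2.1.2, p.1 *: p.2.2) | p <- s].
apply: val_inj; rewrite val_rep_sum [LHS]us big_map.
by apply: eq_bigr => p _; rewrite deltaZ.
Qed.

Definition pairing (s : seq (X * X * E)) (g : lip0 X K^o) (phi : dual E) : K :=
  \sum_(t <- s) (g t.1.1 - g t.1.2) * phi t.2.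

Definition rep_eps (s : seq (X * X * E)) : R :=
  sup [set r | exists (g : lip0 X K^o) (phi : dual E),
    [/\ Lip g <= 1, nrm phi <= 1 & r = nrm (pairing s g phi : K^o)]].

(* Computed on a chosen representation; [lip_epsE] shows that the choice is
   irrelevant. *)
Definition lip_eps (u : lip_tensor) : R := rep_eps (sval (cid (ex_rep u))).

Lemma lip0_tensor_subproof (g : lip0 X K^o) (phi : dual E) :
  (fun x => (g x : K) *: phi) \in @lip0_pred R k X (dual E).
Proof.
have := valP g; rewrite !inE/= => -[g0 [L [L0 Lg]]].
split; first by rewrite g0 scale0r.
exists (L * nrm phi); split=> [|x y]; first by rewrite mulr_ge0// nrm_ge0.
by rewrite -scalerBl nrmZ mulrAC ler_wpM2r// nrm_ge0.
Qed.

Definition lip0_tensor g phi : lip0 X (dual E) :=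
  Lip0 (lip0_tensor_subproof g phi).

Lemma pairingE s g phi : pairing s g phi = val (rep_sum s) (lip0_tensor g phi).
Proof.
rewrite val_rep_sum /pairing; elim: s => [|t s IH]; first by rewrite !big_nil.
rewrite !big_cons IH; congr (_ + _).
by rewrite /= /delta_fun/= -scalerBl.
Qed.

Lemma lip_epsE s : lip_eps (rep_sum s) = rep_eps s.
Proof.
rewrite /lip_eps; case: cid => t /= st; rewrite /rep_eps; congr (sup _).
by apply/seteqP; split=> r [g [phi [g1 phi1 ->]]]; exists g, phi; split=> //;
  rewrite !pairingE st.
Qed.

Definition lip_pi (u : lip_tensor) : R :=
  inf [set \sum_(t <- s) mdist t.1.1 t.1.2 * nrm t.2
      | s in [set s | u = rep_sum s]].

Definition lip_crossnorm (alpha : lip_tensor -> R) : Prop :=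
  forall x y e, alpha (box x y e) = mdist x y * nrm e.

Definition dualizable (alpha : lip_tensor -> R) : Prop :=
  forall (g : lip0 X K^o) (phi : dual E) (s : seq (X * X * E)),
    nrm (pairing s g phi : K^o) <= Lip g * nrm phi * alpha (rep_sum s).

End LipschitzTensorProduct.

(* Main.v *)
Require Import Defs.
From HB Require Import structures.
From mathcomp Require Import all_boot all_order all_algebra.
From mathcomp Require Import all_classical all_reals all_analysis.
From mathcomp Require Import complex ring lra.

(** From left to right, dualizability tested on the two unit balls bounds every
    number in the supremum defining epsilon by [alpha u] ([rep_eps_le]).  The
    triangle inequality along a representation, together with the cross-norm
    identity on each elementary term, bounds [alpha u] by the cost of that
    representation ([crossnorm_le_cost]), hence by the infimum pi.

    From right to left, dualizability follows because the pairing is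
    homogeneous in the Lipschitz function and in the functional, so
    that epsilon, a supremum over unit balls, controls all of them
    ([pairing_le_eps]).  The cross-norm identity holds because epsilon and pi
    already agree on elementary tensors: pi is at most the cost of the
    one-term representation, and epsilon is at least [mdist x y * nrm e]
    ([lip_eps_box_ge]).  The last bound needs two extremal objects: the distance
    to [y], shifted to vanish at the base point, has Lipschitz constant at
    most 1 and separates [x] from [y] by exactly [mdist x y]
    ([ex_lip_attaining]); and a functional of norm at most 1 attains the
    norm of [e] ([ex_norming]).

    The norming functional comes from the Hahn-Banach theorem, in the form that
    a sublinear functional is supported at every point by a linear one
    ([hahn_banach_support]).  The proof orders sublinear functionals pointwise:
    Zorn's lemma gives minimal ones, and minimal ones are linear, so that no
    partially defined functional has to be extended.  The theorem is applied to
    [E] with scalars restricted to the reals, and the real functional [h] so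
    obtained is the real part of a functional over the original scalars, namely
    [h v - i h(i v)] in the complex case. *)

Set Implicit Arguments.
Unset Strict Implicit.
Unset Printing Implicit Defensive.

Import Order.TTheory GRing.Theory Num.Theory.
Import numFieldNormedType.Exports.
Local Open Scope classical_set_scope.
Local Open Scope ring_scope.

(** * Hahn-Banach theorem by minimal sublinear functionals *)

Section HahnBanach.
Context (R : realType) (V : lmodType R).
Implicit Types (p q : V -> R) (u v e : V).

Definition sublinear q : Prop :=
  (forall u v, q (u + v) <= q u + q v) /\
  (forall t v, 0 <= t -> q (t *: v) = t * q v).

Lemma sublinear0 q : sublinear q -> q 0 = 0.
Proof. by move=> [_ qZ]; rewrite -(scale0r 0) qZ// mul0r. Qed.

Lemma sublinear_geN q v : sublinear q -> - q (- v) <= q v.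
Proof.
move=> sq; have := sq.1 v (- v); rewrite subrr (sublinear0 sq).
by rewrite -lerBlDr sub0r.
Qed.

(** Individual members need not be sublinear: it is enough that the family be
    stable, up to decreasing the value, under the two operations.  Both infima used below,
    over a chain and over a half-line of parameters, are of this kind. *)
Lemma sublinear_inf (I : Type) (i0 : I) (F : I -> V -> R) (b : V -> R) :
  (forall i v, b v <= F i v) ->
  (forall i, F i 0 = 0) ->
  (forall i j u v, exists l, F l (u + v) <= F i u + F j v) ->
  (forall i t v, 0 < t -> exists j, F j (t *: v) <= t * F i v) ->
  sublinear (fun v => inf (range (F ^~ v))).
Proof.
move=> bF F0 FD FZ; pose r v := inf (range (F ^~ v)).
have r_le i v : r v <= F i v.
  apply: ge_inf; last by exists i.
  by exists (b v) => _ [j _ <-].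
have rge c v : (forall i, c <= F i v) -> c <= r v.
  move=> cF; apply: lb_le_inf; first by exists (F i0 v), i0.
  by move=> _ [j _ <-].
have rZ t v : 0 < t -> r (t *: v) <= t * r v.
  move=> t0; rewrite -ler_pdivrMl//; apply: (rge _ _) => i.
  have [j] := FZ i t v t0; rewrite ler_pdivrMl//; apply: le_trans.
  exact: r_le.
rewrite -/r; split=> [u v|t v].
  rewrite -lerBlDr; apply: (rge _ _) => i; rewrite lerBlDr -lerBlDl.
  apply: (rge _ _) => j; rewrite lerBlDl.
  by have [l] := FD i j u v; apply: le_trans; exact: r_le.
rewrite le_eqVlt => /predU1P[<-|t0].
  rewrite scale0r mul0r; apply: le_anti; apply/andP; split.
    by rewrite -(F0 i0) r_le.
  by apply: (rge _ _) => i; rewrite F0.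
apply: le_anti; rewrite [X in X && _]rZ//= -ler_pdivlMl//.
have := @rZ t^-1 (t *: v); rewrite invr_gt0 => /(_ t0).
by rewrite scalerA mulVf ?gt_eqF// scale1r.
Qed.

(** The directional device of the convex-analysis proof of Hahn-Banach: among
    the values that [q] allows at [v], it keeps those reached by moving along
    [e] and refunding the cost [t * q e] of the move.  It is a sublinear
    functional below [q] whose value at [- e] is at most [- q e]. *)
Definition shift q e v : R :=
  inf (range (fun t : {t : R | 0 <= t} => q (v + sval t *: e) - sval t * q e)).

Lemma shift_ge q e v t : sublinear q -> 0 <= t ->
  - q (- v) <= q (v + t *: e) - t * q e.
Proof.
move=> [qD qZ] t0; have := qD (v + t *: e) (- v).
by rewrite addrAC subrr add0r qZ//; lra.
Qed.

Lemma shift_le q e v t : sublinear q -> 0 <= t ->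
  shift q e v <= q (v + t *: e) - t * q e.
Proof.
move=> sq t0; apply: ge_inf; last by exists (exist _ t t0).
by exists (- q (- v)) => _ [[s s0] _ <-]; exact: shift_ge.
Qed.

Lemma shift_sublinear q e : sublinear q -> sublinear (shift q e).
Proof.
move=> sq; have [qD qZ] := sq.
apply: (@sublinear_inf {t : R | 0 <= t} (exist _ 0 (lexx 0))
  (fun t v => q (v + sval t *: e) - sval t * q e) (fun v => - q (- v))).
- by move=> [t t0] v; exact: shift_ge.
- by move=> [t t0] /=; rewrite add0r qZ// subrr.
- move=> [s s0] [t t0] u v; exists (exist _ (s + t) (addr_ge0 s0 t0)) => /=.
  by rewrite scalerDl addrACA; have := qD (u + s *: e) (v + t *: e); lra.
- move=> [s s0] t v t0; exists (exist _ (t * s) (mulr_ge0 (ltW t0) s0)) => /=.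
  by rewrite -scalerA -scalerDr (qZ _ _ (ltW t0)) mulrBr mulrA.
Qed.

Lemma shift_le_id q e v : sublinear q -> shift q e v <= q v.
Proof.
move=> sq; apply: le_trans (shift_le e v sq (lexx 0)) _.
by rewrite scale0r addr0 mul0r subr0.
Qed.

Lemma shiftN q e : sublinear q -> shift q e (- e) <= - q e.
Proof.
move=> sq; apply: le_trans (shift_le e (- e) sq ler01) _.
by rewrite scale1r addNr sublinear0// mul1r sub0r.
Qed.

(** A chain has its pointwise infimum as a lower bound; the infimum is finite
    since everything below [p] is bounded below by [fun v => - p (- v)]. *)
Lemma ex_minimal_sublinear p : sublinear p ->
  exists q, [/\ sublinear q, forall v, q v <= p v &
    forall r, sublinear r -> (forall v, r v <= q v) -> r = q].
Proof.
move=> sp; pose P q := sublinear q /\ forall v, q v <= p v.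
pose T := {q | P q}.
pose ge (q r : T) := `[< forall v, sval r v <= sval q v >].
have [||||[q [sq qp]] qmin] := @Zorn T ge.
- by move=> q; apply/asboolP.
- move=> q r s /asboolP rq /asboolP sr; apply/asboolP => v.
  exact: le_trans (sr v) (rq v).
- move=> [q Pq] [r Pr] /asboolP/= rq /asboolP/= qr; apply: eq_exist.
  by apply/funext => v; apply: le_anti; rewrite qr rq.
- move=> A Atot.
  (* Over an empty chain [inf] is a default value, so [p] serves as the bound. *)
  have [[q0 Aq0]|nA] := pselect (A !=set0); last first.
    exists (exist P p (conj sp (fun v => lexx (p v)))) => s As.
    by case: nA; exists s.
  pose I := {q : T | A q}; pose F (i : I) v := sval (sval i) v.
  have bF (i : I) v : - p (- v) <= F i v.
    case: i => [[q [sq qp]] Aq]; rewrite /F/=.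
    by apply: le_trans (sublinear_geN v sq); rewrite lerN2.
  have Finf : sublinear (fun v => inf (range (F ^~ v))).
    apply: (sublinear_inf (exist _ q0 Aq0) bF).
    + by move=> [[q [sq qp]] Aq]; exact: sublinear0.
    + move=> i j u v; case: (Atot _ _ (svalP i) (svalP j)) => /asboolP ij.
        exists j; apply: le_trans ((svalP (sval j)).1.1 u v) _.
        by rewrite lerD2r; exact: ij.
      exists i; apply: le_trans ((svalP (sval i)).1.1 u v) _.
      by rewrite lerD2l; exact: ij.
    + move=> i t v t0; exists i.
      by rewrite /F ((svalP (sval i)).1.2 _ _ (ltW t0)).
  have leF i v : inf (range (F ^~ v)) <= F i v.
    apply: ge_inf; last by exists i.
    by exists (- p (- v)) => _ [j _ <-].
  have lep v : inf (range (F ^~ v)) <= p v.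
    exact: le_trans (leF (exist _ q0 Aq0) v) ((svalP q0).2 v).
  exists (exist P _ (conj Finf lep)) => s As; apply/asboolP => v.
  exact: (leF (exist _ s As)).
exists q; split=> // r sr rq.
have rp v : r v <= p v by exact: le_trans (rq v) (qp v).
have := qmin (exist P r (conj sr rp)) => /(_ _)/(congr1 sval)/=.
by apply; apply/asboolP.
Qed.

(** Minimality forces [shift q v = q] for every [v], hence [q (- v) = - q v];
    an odd sublinear functional is linear. *)
Lemma minimal_sublinear_linear q : sublinear q ->
  (forall r, sublinear r -> (forall v, r v <= q v) -> r = q) ->
  forall a u v, q (a *: u + v) = a * q u + q v.
Proof.
move=> sq qmin; have [qD qZ] := sq.
have qN v : q (- v) = - q v.
  apply: le_anti; apply/andP; split.
    rewrite -{1}(qmin _ (shift_sublinear v sq)) ?shiftN// => w.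
    exact: shift_le_id.
  by rewrite -[v in - q v]opprK; exact: sublinear_geN.
have qA u v : q (u + v) = q u + q v.
  apply: le_anti; rewrite qD/= -[u in q u + _](addrK v).
  by have := qD (u + v) (- v); rewrite qN; lra.
move=> a u v; rewrite qA; congr (_ + _).
have [a0|/ltW a0] := leP 0 a; first exact: qZ.
rewrite -[a]opprK scaleNr qN qZ ?oppr_ge0//; lra.
Qed.

(** Starting Zorn from [shift p e] instead of [p] makes the minimal functional
    take at [- e] a value at most [- p e], hence touch [p] at [e]. *)
Lemma hahn_banach_support p e : sublinear p ->
  exists h : V -> R, [/\ forall a u v, h (a *: u + v) = a * h u + h v,
    forall v, h v <= p v & h e = p e].
Proof.
move=> sp.
have [h [sh hp hmin]] := ex_minimal_sublinear (shift_sublinear e sp).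
have hlin := minimal_sublinear_linear sh hmin.
have hle v : h v <= p v by exact: le_trans (hp v) (shift_le_id e v sp).
exists h; split=> //; apply: le_anti; rewrite hle/=.
have := le_trans (hp (- e)) (shiftN e sp).
by have := hlin (-1) e 0; rewrite scaleN1r addr0 (sublinear0 sh); lra.
Qed.

End HahnBanach.

(** * Norming functionals over the real or complex scalars *)

Section Scalars.
Context (R : realType) (k : scalar_kind).
Local Notation K := (scalars R k).

Lemma nrm_of_real_norm (a : R) : nrm (of_real k a : K^o) = `|a|.
Proof.
have [a0|a0] := leP 0 a; first by rewrite nrm_of_real// ger0_norm.
rewrite ltr0_norm// -(nrm_of_real k (_ : 0 <= - a)) ?oppr_ge0 ?ltW//.
rewrite /nrm -[in RHS]normrN; congr (re_part `|_|).
by apply: (addIr (of_real k (- a))); rewrite addNr -of_realD subrr /of_real; case: k.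
Qed.

Lemma re_part_le_nrm (z : K) : re_part z <= nrm (z : K^o).
Proof.
rewrite -(@of_real_le R k) of_real_nrm; case: k z => /= z; first exact: ler_norm.
by apply: le_trans (normc_ge_Re z); rewrite lecR ler_norm.
Qed.

End Scalars.

Section RealPart.
Context (R : realType) (k : scalar_kind) (E : normedModType (scalars R k)).

(** [E] with its scalars restricted to the reals, a separate type so that the two
    module structures do not compete. *)
Definition realification : Type := E.

HB.instance Definition _ := GRing.Zmodule.on realification.

Let rscale (a : R) (v : realification) : realification := of_real k a *: (v : E).

Let rscaleA a b v : rscale a (rscale b v) = rscale (a * b) v.
Proof. by rewrite /rscale scalerA of_realM. Qed.

Let rscale1 : left_id 1 rscale.
Proof.
by move=> v; rewrite /rscale (_ : of_real k 1 = 1) ?scale1r// /of_real; case: k.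
Qed.

Let rscaleDr : right_distributive rscale +%R.
Proof. by move=> a u v; exact: scalerDr. Qed.

Let rscaleDl v : {morph rscale^~ v : a b / a + b}.
Proof. by move=> a b; rewrite /rscale of_realD scalerDl. Qed.

HB.instance Definition _ := GRing.Zmodule_isLmodule.Build R realification
  rscaleA rscale1 rscaleDr rscaleDl.

Lemma nrm_sublinear : @sublinear R realification (@nrm R k E).
Proof.
split=> [u v|t v t0]; first exact: nrmD.
by rewrite -[t in RHS](nrm_of_real k t0) -nrmZ.
Qed.

End RealPart.

(** A real-linear functional is the real part of a linear one: over the complex
    numbers, [phi v = h v - i h(i v)] is the only candidate, since
    [Im (phi v) = - Re (phi (i v))]. *)
Lemma ex_linear_re_part (R : realType) (k : scalar_kind)
    (E : normedModType (scalars R k)) (h : E -> R) :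
  (forall a u v, h (of_real k a *: u + v) = a * h u + h v) ->
  exists2 phi : E -> (scalars R k)^o, linear phi & forall v, re_part (phi v) = h v.
Proof.
case: k E h => E h hlin; first by exists h.
have hD u v : h (u + v) = h u + h v.
  by rewrite -[u in LHS]scale1r (hlin 1) mul1r.
have hZ a u : h (real_complex R a *: u) = a * h u.
  have h0 : h 0 = 0 by apply: (addIr (h 0)); rewrite -hD !add0r.
  by rewrite -[_ *: u]addr0 hlin h0 addr0.
pose I : R[i] := 'i%C.
exists (fun v => (h v +i* - h (I *: v))%C) => // -[a b] u v.
have -> : (a +i* b)%C = real_complex R a + real_complex R b * I.
  by apply/eqP; rewrite eq_complex /=; apply/andP; split; apply/eqP; ring.
have II : I * I = - 1.
  by apply/eqP; rewrite eq_complex /=; apply/andP; split; apply/eqP; ring.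
have hN w : h (- w) = - h w.
  by apply: (addIr (h w)); rewrite -hD !addNr -(scale0r w) (hZ 0) mul0r.
have hc : h ((real_complex R a + real_complex R b * I) *: u + v) =
    a * h u + b * h (I *: u) + h v.
  by rewrite scalerDl -scalerA !hD !hZ.
have hIc : h (I *: ((real_complex R a + real_complex R b * I) *: u + v)) =
    a * h (I *: u) - b * h u + h (I *: v).
  rewrite scalerDr scalerA mulrDr mulrCA II mulrN1 (mulrC I) scalerBl -scalerA.
  by rewrite !hD hN !hZ.
rewrite hc hIc.
by apply/eqP; rewrite eq_complex /=; apply/andP; split; apply/eqP; ring.
Qed.

(** The bound on [h] passes to [phi] by rotation: for a scalar [a] of modulus 1
    with [a * phi v = |phi v|], the value [phi (a *: v)] is real, so it equals
    [h (a *: v)] and is at most [nrm (a *: v) = nrm v]. *)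
Lemma ex_norming (R : realType) (k : scalar_kind)
    (E : normedModType (scalars R k)) (e : E) :
  exists2 phi : dual E, nrm phi <= 1 & nrm (phi e) = nrm e.
Proof.
have [h [hlin hle he]] :=
  @hahn_banach_support R (realification E) _ e (nrm_sublinear E).
have [phi phiL phih] := @ex_linear_re_part R k E h hlin.
have phiZ (a : scalars R k) v : phi (a *: v) = a * phi v.
  have phi0 : phi 0 = 0.
    by have := phiL (-1) 0 0; rewrite scaler0 addr0 scaleN1r addNr.
  by have := phiL a v 0; rewrite !addr0 phi0 addr0.
have phi1 v : nrm (phi v) <= nrm v.
  have [z0|z0] := eqVneq (phi v) 0; first by rewrite z0 nrm0 nrm_ge0.
  pose a : scalars R k := `|phi v| / phi v.
  have an : nrm (a : (scalars R k)^o) = 1.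
    rewrite /a /nrm normrM normfV normr_id mulfV ?normr_eq0//.
    by rewrite -(normr1 (scalars R k)); exact: nrm1.
  rewrite /nrm -[`|phi v|](divfK z0) -phiZ phih -[leRHS]mul1r -an -nrmZ.
  exact: hle.
pose phi' : {linear E -> (scalars R k)^o} := HB.pack phi (GRing.isLinear.Build _ _ _ _ phi phiL).
have phiC : continuous phi.
  have /linear_bounded_continuous// : bounded_near phi' (nbhs (0 : E)).
  apply/linear_boundedP; near=> C => v.
  apply: (@le_trans _ _ `|v|).
    by rewrite -(of_real_nrm (phi v)) -of_real_nrm of_real_le.
  by rewrite ler_peMl//; near: C; exact: nbhs_pinfty_ge.
have phiP : phi \in @dual_pred R k E by rewrite inE.
exists (Dual phiP) => /=.
  rewrite dual_normE; apply: dual_norm_le => v; exact: le_trans (phi1 v).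
apply: le_anti; rewrite phi1/= -he -phih; exact: re_part_le_nrm.
Unshelve. all: by end_near.
Qed.

(** * Least Lipschitz constants *)

Section LipschitzConstant.
Context (R : realType) (k : scalar_kind) (X : pointedMetricType R).
Local Notation K := (scalars R k).
Context (F : normedModType K).
Implicit Types f : lip0 X F.

Lemma lip_const_nonempty f : lip_const f !=set0.
Proof. by have := valP f; rewrite inE => -[]. Qed.

Lemma Lip_le f L : lip_const f L -> Lip f <= L.
Proof. by move=> fL; apply: ge_inf => //; exists 0 => M []. Qed.

Lemma Lip_ge0 f : 0 <= Lip f.
Proof. by apply: lb_le_inf; [exact: lip_const_nonempty|move=> M []]. Qed.

(** The infimum of the Lipschitz constants is itself one.  Equal points
    are separated out because the proof divides by the distance. *)
Lemma Lip_lipschitz f x y : nrm (f x - f y) <= Lip f * mdist x y.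
Proof.
have [<-|xy] := eqVneq x y; first by rewrite subrr nrm0 mulr_ge0 ?Lip_ge0 ?mdist_ge0.
have d0 : 0 < mdist x y by rewrite mdist_gt0.
rewrite -ler_pdivrMr//; apply: lb_le_inf; first exact: lip_const_nonempty.
by move=> L [_ fL]; rewrite ler_pdivrMr.
Qed.

Lemma LipZ_le (a : K) f : Lip (a *: f) <= nrm (a : K^o) * Lip f.
Proof.
apply: Lip_le; split=> [|x y]; first by rewrite mulr_ge0 ?nrm_ge0 ?Lip_ge0.
rewrite [_ - _](_ : _ = a *: (f x - f y)); last by rewrite scalerBr.
by rewrite nrmZ -mulrA ler_wpM2l ?nrm_ge0 ?Lip_lipschitz.
Qed.

End LipschitzConstant.

Section DistanceFunction.
Context (R : realType) (k : scalar_kind) (X : pointedMetricType R).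
Local Notation K := (scalars R k).

Lemma dist_to_lipschitz (y : X) :
  lip_const (fun x => of_real k (mdist x y - mdist point y) : K^o) 1.
Proof.
split=> // x z; rewrite mul1r.
rewrite (_ : _ - _ = of_real k (mdist x y - mdist z y)); last first.
  apply: (addIr (of_real k (mdist z y - mdist point y))).
  by rewrite subrK -of_realD addrA subrK.
rewrite nrm_of_real_norm ler_distl lerBlDr addrC.
have := metric_triangle x z y; have := metric_triangle z x y.
by rewrite (metric_sym z x); lra.
Qed.

Lemma ex_lip_attaining (x y : X) :
  exists2 g : lip0 X K^o, Lip g <= 1 & nrm (g x - g y) = mdist x y.
Proof.
pose f x : K^o := of_real k (mdist x y - mdist point y).
have fP : f \in @lip0_pred R k X K^o.
  rewrite inE; split; last by exists 1; exact: dist_to_lipschitz.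
  by rewrite /f subrr /of_real; case: k.
exists (Lip0 fP); first by apply: Lip_le; exact: dist_to_lipschitz.
have -> : Lip0 fP x - Lip0 fP y = of_real k (mdist x y) :> K.
  apply: (addIr (Lip0 fP y : K)); rewrite subrK -of_realD /= /f.
  by rewrite mdistxx sub0r.
by rewrite nrm_of_real_norm ger0_norm ?mdist_ge0.
Qed.

End DistanceFunction.

(** * The pairing, and the extreme cross-norms *)

Section Pairing.
Context (R : realType) (k : scalar_kind) (X : pointedMetricType R).
Local Notation K := (scalars R k).
Context (E : normedModType K).
Implicit Types (s : seq (X * X * E)) (g : lip0 X K^o) (phi : dual E).

Definition rep_cost s : R := \sum_(t <- s) mdist t.1.1 t.1.2 * nrm t.2.

Lemma pairingZl s (a : K) g phi : pairing s (a *: g) phi = a * pairing s g phi.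
Proof.
rewrite /pairing mulr_sumr; apply: eq_bigr => t _.
by rewrite mulrA mulrBr.
Qed.

Lemma pairingZr s (a : K) g phi : pairing s g (a *: phi) = a * pairing s g phi.
Proof.
rewrite /pairing mulr_sumr; apply: eq_bigr => t _.
by rewrite mulrCA.
Qed.

(** This bound makes the supremum defining epsilon finite, and disposes of the
    degenerate case where [Lip g * nrm phi] vanishes. *)
Lemma pairing_le_cost s g phi :
  nrm (pairing s g phi : K^o) <= Lip g * nrm phi * rep_cost s.
Proof.
rewrite /pairing /rep_cost; elim: s => [|t s IH].
  by rewrite !big_nil nrm0 mulr0.
rewrite !big_cons mulrDr; apply: le_trans (nrmD _ _) _; apply: lerD => //.
rewrite (nrmZ (g t.1.1 - g t.1.2) (phi t.2)) mulrACA.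
apply: ler_pM; rewrite ?nrm_ge0 ?Lip_lipschitz// dual_normE.
exact: dual_norm_ge.
Qed.

Lemma pairing_le_unit s g phi : Lip g <= 1 -> nrm phi <= 1 ->
  nrm (pairing s g phi : K^o) <= rep_eps s.
Proof.
move=> g1 phi1; apply: ub_le_sup; last by exists g, phi.
exists (rep_cost s) => _ [g' [phi' [g'1 phi'1 ->]]].
apply: le_trans (pairing_le_cost s g' phi') _.
rewrite -[leRHS]mul1r ler_wpM2r//.
  by apply: sumr_ge0 => t _; rewrite mulr_ge0 ?mdist_ge0 ?nrm_ge0.
by rewrite mulr_ile1 ?Lip_ge0 ?nrm_ge0.
Qed.

Lemma rep_eps_le s C :
  (forall g phi, Lip g <= 1 -> nrm phi <= 1 -> nrm (pairing s g phi : K^o) <= C) ->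
  rep_eps s <= C.
Proof.
move=> H; apply: ge_sup; last by move=> _ [g [phi [g1 phi1 ->]]]; exact: H.
exists (nrm (pairing s 0 0 : K^o)), 0, 0; split=> //; last by rewrite nrm0.
apply: le_trans ler01; apply: Lip_le; split=> // x y.
by rewrite subrr nrm0 mul0r.
Qed.

(** Epsilon only tests unit balls; normalizing [g] and [phi] extends its bound to
    all of them. *)
Lemma pairing_le_eps s g phi :
  nrm (pairing s g phi : K^o) <= Lip g * nrm phi * rep_eps s.
Proof.
have [Lphi0|Lphi0] := eqVneq (Lip g * nrm phi) 0.
  by have := pairing_le_cost s g phi; rewrite Lphi0 !mul0r.
have L0 : 0 < Lip g.
  by rewrite lt_neqAle Lip_ge0 andbT eq_sym; apply: contraNneq Lphi0 => ->; rewrite mul0r.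
have phi0 : 0 < nrm phi.
  by rewrite lt_neqAle nrm_ge0 andbT eq_sym; apply: contraNneq Lphi0 => ->; rewrite mulr0.
pose a : K := of_real k (Lip g)^-1; pose b : K := of_real k (nrm phi)^-1.
have na : nrm (a : K^o) = (Lip g)^-1 by rewrite nrm_of_real// invr_ge0 ltW.
have nb : nrm (b : K^o) = (nrm phi)^-1 by rewrite nrm_of_real// invr_ge0 ltW.
have := @pairing_le_unit s (a *: g) (b *: phi).
rewrite pairingZl pairingZr.
rewrite (nrmZ a (b * pairing s g phi : K^o)) (nrmZ b (pairing s g phi : K^o)).
rewrite (nrmZ b phi) na nb !mulVf ?gt_eqF//.
rewrite ler_pdivrMl// ler_pdivrMl// mulrA (mulrC (nrm phi)); apply=> //.
by apply: le_trans (LipZ_le _ _) _; rewrite na mulVf ?gt_eqF.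
Qed.

(** On an elementary tensor the pairing is a product, so a single pair [g], [phi]
    made of the two extremal objects reaches the value. *)
Lemma lip_eps_box_ge (x y : X) (e : E) : mdist x y * nrm e <= lip_eps (box x y e).
Proof.
have [g g1 gxy] := @ex_lip_attaining R k X x y.
have [phi phi1 phie] := ex_norming e.
have -> : box x y e = rep_sum [:: (x, y, e)] by rewrite /rep_sum big_seq1.
rewrite lip_epsE; have := pairing_le_unit [:: (x, y, e)] g1 phi1.
by rewrite /pairing big_seq1/= (nrmZ (g x - g y) (phi e)) gxy phie.
Qed.

Lemma lip_pi_rep_sum_le s : lip_pi (rep_sum s) <= rep_cost s.
Proof.
apply: ge_inf; last by exists s.
exists 0 => _ [t _ <-]; apply: sumr_ge0 => i _.
by rewrite mulr_ge0 ?mdist_ge0 ?nrm_ge0.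
Qed.

Lemma lip_pi_ge (u : lip_tensor X E) C :
  (forall s, u = rep_sum s -> C <= rep_cost s) -> C <= lip_pi u.
Proof.
move=> H; apply: lb_le_inf; last by move=> _ [s us <-]; exact: H.
by have [s us] := ex_rep u; exists (rep_cost s), s.
Qed.

Lemma crossnorm_le_cost (alpha : lip_tensor X E -> R) s :
  is_norm alpha -> lip_crossnorm alpha -> alpha (rep_sum s) <= rep_cost s.
Proof.
move=> [_ _ alphaZ alphaD] cross; rewrite /rep_sum /rep_cost.
elim: s => [|t s IH].
  by rewrite !big_nil -(scale0r 0) alphaZ nrm0 mul0r.
by rewrite !big_cons; apply: le_trans (alphaD _ _) _; rewrite cross lerD2l.
Qed.

End Pairing.

Theorem proposition6p5 (R : realType) (k : scalar_kind)
    (X : pointedMetricType R) (E : completeNormedModType (scalars R k))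
    (alpha : lip_tensor X E -> R) :
  is_norm alpha ->
  ((lip_crossnorm alpha /\ dualizable alpha) <->
  (forall u : lip_tensor X E, lip_eps u <= alpha u /\ alpha u <= lip_pi u)).
Proof.
move=> Nalpha; have [alpha0 _ _ _] := Nalpha; split.
  move=> [cross dualiz] u; split; last first.
    by apply: lip_pi_ge => s ->; exact: crossnorm_le_cost.
  have [s ->] := ex_rep u; rewrite lip_epsE; apply: rep_eps_le => g phi g1 phi1.
  apply: le_trans (dualiz g phi s) _.
  by rewrite ler_piMl// mulr_ile1 ?Lip_ge0 ?nrm_ge0.
move=> between; split=> [x y e|g phi s].
  have [eps_le le_pi] := between (box x y e).
  apply: le_anti; rewrite (le_trans (lip_eps_box_ge x y e) eps_le) andbT.
  apply: le_trans le_pi _.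
  have -> : box x y e = rep_sum [:: (x, y, e)] by rewrite /rep_sum big_seq1.
  by apply: le_trans (lip_pi_rep_sum_le _) _; rewrite /rep_cost big_seq1.
apply: le_trans (pairing_le_eps s g phi) _.
rewrite ler_wpM2l ?mulr_ge0 ?Lip_ge0 ?nrm_ge0// -lip_epsE.
by have [] := between (rep_sum s).
Qed.
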